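(* For all $k\in(1,\infty)$, $$\dim_H\left\{x\in(0,1]\colon\frac{p'_{n+1}(x)}{p'_n(x)}\leq k\ \text{ for all } n\in\mathbb{N}\right\}=1,$$ where $p'_n(x)$ denotes the $n$th digit of the modified Engel expansion of $x$ and $\dim_H$ is the Hausdorff dimension.
   Context: $\mathbb{N}=\{1,2,3,\dots\}$; $k$ is a real number. Modified Engel expansion: every $x\in(0,1]$ has a unique representation $$x=\frac{1}{p'_1}+\frac{1}{(p'_1-1)p'_2}+\frac{1}{(p'_1-1)(p'_2-1)p'_3}+\cdots$$ as an infinite series, with natural numbers $p'_1\ge2$ and $p'_{n+1}\ge p'_n+1$ for all $n$; put $p'_n(x)=p'_n$. *)

(* Defs.v *)
From HB Require Import structures.
From mathcomp Require Import all_boot all_order all_algebra ring.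
From mathcomp Require Import all_classical all_reals all_analysis.

Set Implicit Arguments.
Unset Strict Implicit.
Unset Printing Implicit Defensive.

Import Order.TTheory GRing.Theory Num.Theory.
Import numFieldNormedType.Exports.

Local Open Scope classical_set_scope.
Local Open Scope ring_scope.

Section HausdorffDimension.
Variable R : realType.
Implicit Types (A : set R) (s delta : R).

(* [-oo] on the empty set. *)
Definition ediam A : \bar R :=
  ereal_sup [set `|z.1 - z.2|%:E | z in A `*` A].

(* The empty set is treated apart so that it costs [0] even when [s = 0];
   nonempty sets cost [1] when [s = 0]. *)
Definition diam_powR s A : \bar R :=
  if `[< A = set0 >] then 0%E else (ediam A `^ s)%E.

Definition hausdorff_premeasure s delta A : \bar R :=
  ereal_inf [set (\sum_(0 <= i <oo) diam_powR s (U i))%E |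
    U in [set U : nat -> set R |
      (forall i, (ediam (U i) <= delta%:E)%E) /\ A `<=` \bigcup_i U i]].

(* The premeasure is nonincreasing in [delta], so that the supremum is the
   limit as [delta] tends to [0]. *)
Definition hausdorff_measure s A : \bar R :=
  ereal_sup [set hausdorff_premeasure s delta A |
    delta in [set delta : R | 0 < delta]].

Definition hausdorff_dim A : \bar R :=
  ereal_inf [set s%:E | s in
    [set s : R | 0 <= s /\ hausdorff_measure s A = 0%E]].

End HausdorffDimension.

Section ModifiedEngel.
Variable R : realType.
Implicit Types (p : nat -> nat) (x : R).

(* Digit sequences are indexed from [0]: [p n] stands for p'_(n+1). *)
Definition mengel_term p (n : nat) : R :=
  (\prod_(i < n) ((p i)%:R - 1) * (p n)%:R)^-1.

Definition is_mengel_expansion x p : Prop :=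
  [/\ (2 <= p 0)%N, (forall n, (p n + 1 <= p n.+1)%N) &
      series (mengel_term p) @ \oo --> x].

(* By [mengel_expansion_exists] and [mengel_expansion_unique] below, for [x] in
   ]0, 1] this is the one expansion of [x] and the default value is not used. *)
Definition mengel_digit x : nat -> nat :=
  xget (fun=> 0%N) [set p | is_mengel_expansion x p].

Let tail p : nat -> nat := fun n => p n.+1.

Let digits_ge p : (2 <= p 0)%N -> (forall n, (p n + 1 <= p n.+1)%N) ->
  forall n, (n.+2 <= p n)%N.
Proof.
move=> p0 pS; elim=> [//|n IH]; apply: leq_trans (pS n).
by rewrite addn1 ltnS.
Qed.

Let pred_gt0 m : (2 <= m)%N -> 0 < m%:R - 1 :> R.
Proof. by move=> m2; rewrite subr_gt0 ltr1n. Qed.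

Let digit_gt0 m : (2 <= m)%N -> 0 < m%:R :> R.
Proof. by move=> m2; rewrite ltr0n (leq_trans _ m2). Qed.

Let digit_id m : (2 <= m)%N ->
  m%:R^-1 + (m%:R - 1)^-1 * m%:R^-1 = (m%:R - 1)^-1 :> R.
Proof.
move=> m2; have := gt_eqF (pred_gt0 m2); have := gt_eqF (digit_gt0 m2).
by move=> /negbT h0 /negbT h1; field; rewrite h0 h1.
Qed.

Let series_tail p n : series (mengel_term p) n.+1 =
  (p 0)%:R^-1 + ((p 0)%:R - 1)^-1 * series (mengel_term (tail p)) n.
Proof.
rewrite /series /= !big_mkord big_ord_recl; congr (_ + _).
  by rewrite /mengel_term big_ord0 mul1r.
rewrite mulr_sumr; apply: eq_bigr => i _.
by rewrite /mengel_term lift0 big_ord_recl -mulrA invfM.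
Qed.

Let series_bound p n : (2 <= p 0)%N -> (forall n, (p n + 1 <= p n.+1)%N) ->
  0 <= series (mengel_term p) n <= ((p 0)%:R - 1)^-1.
Proof.
elim: n p => [|n IH] p p0 pS.
  by rewrite /series /= big_geq// lexx invr_ge0 ltW// pred_gt0.
have p1 : (2 <= tail p 0)%N by rewrite (leq_trans _ (pS 0%N))// addn1 ltnS ltnW.
have /andP[h1 h2] := IH (tail p) p1 (fun n => pS n.+1).
have h3 : (tail p 0)%:R - 1 >= (p 0)%:R :> R.
  by rewrite lerBrDr natr1 ler_nat -addn1; exact: pS.
rewrite series_tail addr_ge0 ?mulr_ge0 ?invr_ge0 ?(ltW (pred_gt0 _))//=.
rewrite -[leRHS]digit_id// lerD2l ler_wpM2l ?invr_ge0 ?(ltW (pred_gt0 _))//.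
by apply: le_trans h2 _; rewrite lef_pV2 ?posrE ?pred_gt0 ?digit_gt0.
Qed.

Let expansion_tail x p : is_mengel_expansion x p ->
  is_mengel_expansion ((x - (p 0)%:R^-1) * ((p 0)%:R - 1)) (tail p).
Proof.
move=> [p0 pS px]; split; last 2 first.
- by move=> n; exact: pS.
- have -> : series (mengel_term (tail p)) = (fun n : nat =>
      (series (mengel_term p) n.+1 - (p 0)%:R^-1) * ((p 0)%:R - 1)).
    apply/funext => n; rewrite series_tail [X in X - _]addrC addrK mulrAC mulVf.
      by rewrite mul1r.
    by rewrite gt_eqF// pred_gt0.
  apply: cvgM; last exact: cvg_cst.
  apply: cvgB; last exact: cvg_cst.
  by move: px; rewrite -(cvg_shiftS (series (mengel_term p))).
- by rewrite (leq_trans _ (pS 0%N))// addn1 ltnS ltnW.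
Qed.

Let expansion_bound x p : is_mengel_expansion x p ->
  0 <= x <= ((p 0)%:R - 1)^-1.
Proof.
move=> [p0 pS px].
have h n := @series_bound p n p0 pS.
apply/andP; split.
  by apply: cvgr_to_ge px _; near=> n; have /andP[] := h n.
by apply: cvgr_to_le px _; near=> n; have /andP[] := h n.
Unshelve. all: by end_near. Qed.

Let tail_expand x m : (2 <= m)%N ->
  x = m%:R^-1 + (m%:R - 1)^-1 * ((x - m%:R^-1) * (m%:R - 1)) :> R.
Proof.
move=> m2; rewrite mulrCA mulVf ?gt_eqF ?pred_gt0// mulr1.
by rewrite [RHS]addrC subrK.
Qed.

Let expansion_gt x p : is_mengel_expansion x p -> (p 0)%:R^-1 < x.
Proof.
move=> ex; have [p0 pS _] := ex.
have et := expansion_tail ex; have [t0 tS _] := et.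
have ett := expansion_tail et; have /andP[h _] := expansion_bound ett.
rewrite [ltRHS](tail_expand _ p0) ltrDl mulr_gt0 ?invr_gt0 ?pred_gt0//.
rewrite [ltRHS](tail_expand _ t0) ltr_pwDl ?invr_gt0 ?digit_gt0//.
by rewrite mulr_ge0// invr_ge0 ltW// pred_gt0.
Qed.

Let digit_leq x m n : (2 <= n)%N -> m%:R^-1 < x -> x <= (n%:R - 1)^-1 ->
  (2 <= m)%N -> (n <= m)%N.
Proof.
move=> n2 mx xn m2; have := lt_le_trans mx xn.
rewrite ltf_pV2 ?posrE ?pred_gt0 ?digit_gt0// ltrBlDr natr1 ltr_nat ltnS.
by [].
Qed.

Lemma mengel_expansion_unique x p q :
  is_mengel_expansion x p -> is_mengel_expansion x q -> p = q.
Proof.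
move=> ep eq; apply/funext => n; elim: n x p q ep eq => [|n IH] x p q ep eq.
  have /andP[_ xp] := expansion_bound ep; have px := expansion_gt ep.
  have /andP[_ xq] := expansion_bound eq; have qx := expansion_gt eq.
  have [p0 _ _] := ep; have [q0 _ _] := eq.
  by apply/eqP; rewrite eqn_leq (digit_leq p0 qx xp)// (digit_leq q0 px xq).
apply: (IH _ (tail p) (tail q) (expansion_tail ep)).
suff -> : p 0%N = q 0%N by exact: (expansion_tail eq).
have /andP[_ xp] := expansion_bound ep; have px := expansion_gt ep.
have /andP[_ xq] := expansion_bound eq; have qx := expansion_gt eq.
have [p0 _ _] := ep; have [q0 _ _] := eq.
by apply/eqP; rewrite eqn_leq (digit_leq p0 qx xp)// (digit_leq q0 px xq).
Qed.

Let dig x : nat := (Num.truncn x^-1).+1.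
Let shift x : R := (x - (dig x)%:R^-1) * ((dig x)%:R - 1).

Let dig_spec x : 0 < x <= 1 ->
  [/\ (2 <= dig x)%N, (dig x)%:R^-1 < x & x <= ((dig x)%:R - 1)^-1].
Proof.
move=> /andP[x0 x1]; have d2 : (2 <= dig x)%N.
  by rewrite ltnS truncn_gt0 -invr1 lef_pV2 ?posrE.
have h : (Num.truncn x^-1)%:R <= x^-1 < (Num.truncn x^-1).+1%:R.
  by apply: truncn_itv; rewrite invr_ge0 ltW.
have /andP[h1 h2] := h; split => //.
  by rewrite -[ltRHS]invrK ltf_pV2 ?posrE ?invr_gt0// digit_gt0.
rewrite -[leLHS]invrK lef_pV2 ?posrE ?invr_gt0 ?pred_gt0//.
by rewrite /dig -natr1 addrK.
Qed.

Let shift_spec x : 0 < x <= 1 -> 0 < shift x <= (dig x)%:R^-1.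
Proof.
move=> x01; have [d2 h1 h2] := dig_spec x01.
rewrite mulr_gt0 ?subr_gt0 ?ltr1n//= -ler_pdivlMr ?pred_gt0//.
rewrite lerBlDl [X in _ + X]mulrC digit_id//.
Qed.

Lemma mengel_expansion_exists x : 0 < x <= 1 ->
  exists p, is_mengel_expansion x p.
Proof.
move=> x01; pose y n := iter n shift x; pose p n := dig (y n).
have y01 n : 0 < y n <= 1.
  elim: n => [//|n IH]; have /andP[h1 h2] := shift_spec IH.
  by rewrite [y _.+1]iterS h1/= (le_trans h2)// invf_le1 ?ler1n ?ltr0n.
have p2 n : (2 <= p n)%N by have [] := dig_spec (y01 n).
have pS n : (p n + 1 <= p n.+1)%N.
  have [_ h1 _] := dig_spec (y01 n.+1); have /andP[_ h2] := shift_spec (y01 n).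
  have := lt_le_trans h1 h2.
  by rewrite addn1 ltf_pV2 ?posrE ?ltr0n// ltr_nat.
have pn := digits_ge (p2 0%N) pS.
have pP n : 1 <= \prod_(i < n) ((p i)%:R - 1) :> R.
  elim: n => [|n IH]; first by rewrite big_ord0.
  rewrite big_ord_recr/= mulr_ege1// lerBrDr (_ : 1 + 1 = 2%:R)// ler_nat.
  exact: p2.
have rem n : x - series (mengel_term p) n =
    (\prod_(i < n) ((p i)%:R - 1))^-1 * y n.
  elim: n => [|n IH].
    by rewrite /series/= big_geq// subr0 big_ord0 invr1 mul1r.
  rewrite seriesSr opprD addrA IH [y n in LHS](tail_expand _ (p2 n)).
  rewrite big_ord_recr /= /mengel_term !invfM mulrDr [LHS]addrAC subrr add0r.
  by rewrite mulrA.
exists p; split; [exact: p2|exact: pS|].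
have cv : (fun n : nat => x - series (mengel_term p) n) @ \oo --> (0 : R).
  apply: (@squeeze_cvgr _ \oo _ R (fun=> 0) harmonic); [|exact: cvg_cst|exact: cvg_harmonic].
  near=> n; rewrite rem; have /andP[h1 h2] := y01 n.
  have P0 := lt_le_trans ltr01 (pP n).
  apply/andP; split; first by rewrite mulr_ge0// ?invr_ge0 ltW.
  apply: (@le_trans _ _ (y n)).
    by rewrite ler_piMl ?(ltW h1)// invf_le1.
  have [_ _ h3] := dig_spec (y01 n); apply: le_trans h3 _.
  rewrite lef_pV2 ?posrE ?pred_gt0// ?p2// lerBrDr natr1 ler_nat; exact: pn.
rewrite (_ : series _ = fun n => x - (x - series (mengel_term p) n)).
  by rewrite -[X in _ --> X]subr0; apply: cvgB cv; exact: cvg_cst.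
by apply/funext => n; rewrite opprB addrC subrK.
Unshelve. all: by end_near. Qed.

Lemma mengel_digitP x : 0 < x <= 1 -> is_mengel_expansion x (mengel_digit x).
Proof. by move=> /mengel_expansion_exists; exact: xgetPex. Qed.

End ModifiedEngel.

(* Main.v *)
Require Import Defs.
From mathcomp Require Import all_boot all_order all_algebra ring lra.
From mathcomp Require Import all_classical all_reals all_analysis.
Import Order.TTheory GRing.Theory Num.Theory.
Import numFieldNormedType.Exports.
Local Open Scope classical_set_scope.
Local Open Scope ring_scope.

Set Implicit Arguments.
Unset Strict Implicit.
Unset Printing Implicit Defensive.

(** Why the dimension is [1].  A block of digits [p_0, ..., p_n] is the address
    of an interval whose length is the reciprocal of
    [(p_0 - 1) ... (p_n - 1)], up to a factor polynomial in [p_n], and the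
    constraint [p_(n+1) <= k p_n] leaves about [(k - 1) p_n] choices for the
    next digit.  The number of admissible blocks thus nearly equals the
    reciprocal of their length: the two differ by an exponential factor, while
    the lengths are at most [1 / n!].  An exponential factor is negligible against
    [(n!) ^ (1 - s)] for each [s < 1].

    The lower bound makes this precise without constructing a measure on the
    set.  Fix a large first digit [M].  Reading [t] in [0, 1[ as a mixed-radix
    expansion, whose radix at each step is the number [branches q] of digits
    allowed after the digit [q], gives a digit sequence [code k M t] and a
    point [coded_point k M t] of the set.  If the sequences of [t] and [t']
    first differ after the digit of index [n], then

    - [|t - t'|] is at most the difference of the two digits, plus one, divided
      by the product of the radices ([code_split_dist]);
    - the two points are at distance at least a constant times the same
      difference, divided by [p_n ^ 2 (p_0 - 1) ... (p_n - 1)]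
      ([mengel_dist_ge]).  The bound [k] on the digits is what makes this hold
      even for adjacent digits: it keeps the tail of the expansion of the
      larger point away from zero.

    Together with [p_n <= M k ^ n] and [branches q >= (k - 1) q / 2] this gives
    [|t - t'| <= A B ^ n |x - x'|] for the coded points [x] and [x'], where
    moreover [|x - x'| <= 1 / n!].  Giving up the power [1 - s] of [|x - x'|]
    absorbs [B ^ n], so that [|t - t'| <= C |x - x'| ^ s]
    ([coded_point_holder]).  A cover of the set by sets [U_i] then pulls back to
    a cover of [0, 1[ by sets of diameter at most [C (diam U_i) ^ s], and the
    subadditivity of Lebesgue measure bounds the sum of the [(diam U_i) ^ s]
    away from zero ([holder_hausdorff_measure_gt0]).

    The upper bound is the covering of [0, 1] by [N] intervals of length
    [1 / N] ([hausdorff_dim_unit_itv_le1]). *)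

(** * Bounds on Hausdorff measure and dimension of sets of reals *)

Section HausdorffBounds.
Variable R : realType.
Implicit Types (A U : set R) (s C : R).

Lemma le_ediam U x y : U x -> U y -> (`|x - y|%:E <= ediam U)%E.
Proof. by move=> Ux Uy; apply: ereal_sup_ubound; exists (x, y). Qed.

Lemma ediam_ge0 U x : U x -> (0 <= ediam U)%E.
Proof. by move=> Ux; rewrite (le_trans _ (le_ediam Ux Ux))// lee_fin. Qed.

Lemma diam_powR_ge0 s U : (0 <= diam_powR s U)%E.
Proof. by rewrite /diam_powR; case: ifP => // _; exact: poweR_ge0. Qed.

Lemma diam_powR_nonempty s U x : U x -> diam_powR s U = (ediam U `^ s)%E.
Proof.
by move=> Ux; rewrite /diam_powR; case: asboolP => // U0; rewrite U0 in Ux.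
Qed.

Lemma dist_powR_le_diam s U x y : 0 <= s -> U x -> U y ->
  ((`|x - y| `^ s)%:E <= diam_powR s U)%E.
Proof.
move=> s0 Ux Uy; rewrite (diam_powR_nonempty _ Ux) -poweR_EFin.
apply: gt0_ler_poweR => //; last exact: le_ediam.
  by rewrite in_itv/= lee_fin normr_ge0 leey.
by rewrite in_itv/= (ediam_ge0 Ux) leey.
Qed.

(** The sets [U i] pull back to sets [V i] that cover the unit interval and have
    diameter at most [C * diam_powR s (U i)].  Each nonempty [V i] lies in the
    closed interval of this radius around any of its points, which is
    measurable whatever [U i] and [g] are; the factor [2] in the bound is the
    price of using a radius. *)
Lemma holder_cover_ge (g : R -> R) s C (U : nat -> set R) :
  0 <= s -> 0 < C ->
  (forall t t', 0 <= t < 1 -> 0 <= t' < 1 ->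
    `|t - t'| <= C * `|g t - g t'| `^ s) ->
  (forall i, (ediam (U i) < +oo)%E) ->
  g @` `[0, 1[ `<=` \bigcup_i U i ->
  ((2 * C)^-1%:E <= \sum_(0 <= i <oo) diam_powR s (U i))%E.
Proof.
move=> s0 C0 gH Ufin UA.
pose V i : set R := [set t | 0 <= t < 1 /\ U i (g t)].
pose v i := xget 0 (V i).
pose r i := C * fine (diam_powR s (U i)).
have r0 i : 0 <= r i by rewrite mulr_ge0 ?fine_ge0 ?diam_powR_ge0// ltW.
pose W i : set R := `[v i - r i, v i + r i]%classic.
have mW i : lebesgue_measure (W i) = (2 * r i)%:E.
  rewrite /W lebesgue_measure_itv/= lte_fin; have := r0 i.
  case: ltP => [_ _|h h0]; first by rewrite -EFinB; congr EFin; ring.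
  by congr EFin; lra.
have VW i t : V i t -> W i t.
  move=> Vt; have [v01 Uv] : V i (v i) by apply: xgetPex; exists t.
  have [t01 Ut] := Vt.
  rewrite /W/= in_itv/= -ler_distlC; apply: le_trans (gH _ _ v01 t01) _.
  rewrite ler_pM2l// -lee_fin fineK; first exact: dist_powR_le_diam.
  rewrite ge0_fin_numE ?diam_powR_ge0// (diam_powR_nonempty _ Uv).
  exact: poweR_lty.
have cover : `[0, 1[%classic `<=` \bigcup_i W i.
  move=> t; rewrite /= in_itv/= => t01.
  have [i _ Ui] : (\bigcup_i U i) (g t).
    by apply: UA; exists t => //=; rewrite in_itv.
  by exists i => //; apply: VW.
rewrite -[leRHS]mul1e -[in leRHS](@mulVf _ (2 * C)) ?gt_eqF ?mulr_gt0//.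
rewrite EFinM -muleA -[leLHS]mule1.
apply: lee_wpmul2l; first by rewrite lee_fin invr_ge0 mulr_ge0// ltW.
rewrite -nneseriesZl; last by move=> i _; exact: diam_powR_ge0.
have : (lebesgue_measure `[0%R, 1%R[%classic <=
    \sum_(0 <= i <oo) lebesgue_measure (W i))%E.
  by apply: measure_sigma_subadditive => // i; exact: measurable_itv.
rewrite lebesgue_measure_itv/= lte_fin ltr01 -EFinB subr0 => /le_trans; apply.
apply: lee_nneseries => [i _ _|i _ /=]; rewrite mW.
  by rewrite lee_fin mulr_ge0.
rewrite /r mulrA EFinM.
apply: lee_wpmul2l; first by rewrite lee_fin mulr_ge0// ltW.
have := diam_powR_ge0 s (U i).
by case: (diam_powR s (U i)) => //= _; rewrite leey.
Qed.

(** A substitute for the mass distribution principle: when [s > 0], the inverse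
    of [g] is Hölder of exponent [s] from a part of [A] onto [0, 1[, and such a
    map cannot send an [s]-null set onto a set of positive length. *)
Lemma holder_hausdorff_measure_gt0 A (g : R -> R) s C :
  0 <= s -> 0 < C -> (forall t, 0 <= t < 1 -> A (g t)) ->
  (forall t t', 0 <= t < 1 -> 0 <= t' < 1 ->
    `|t - t'| <= C * `|g t - g t'| `^ s) ->
  (0 < hausdorff_measure s A)%E.
Proof.
move=> s0 C0 gA gH.
apply: (@lt_le_trans _ _ (hausdorff_premeasure s 1 A)); last first.
  by apply: ereal_sup_ubound; exists 1 => //=; exact: ltr01.
apply: (@lt_le_trans _ _ ((2 * C)^-1%:E)).
  by rewrite lte_fin invr_gt0 mulr_gt0.
apply: le_ereal_inf_tmp => _ [U [Udiam UA] <-].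
apply: (@holder_cover_ge g) => // [i|_ [t /= t01 <-]].
  by rewrite (le_lt_trans (Udiam i))// ltry.
by apply: UA; apply: gA; move: t01; rewrite in_itv.
Qed.

Lemma ediam_itv (a b : R) : a <= b -> ediam `[a, b]%classic = (b - a)%:E.
Proof.
move=> ab; apply/eqP; rewrite eq_le; apply/andP; split.
  apply: ge_ereal_sup => _ [[x y] [/= xab yab] <-]; rewrite lee_fin.
  move: xab yab; rewrite !in_itv/= => /andP[ax xb] /andP[ay yb].
  by rewrite ler_norml; lra.
rewrite -[b - a]ger0_norm ?subr_ge0//.
by apply: le_ediam; rewrite /= in_itv/= ?ab ?lexx.
Qed.

(** [N] intervals of length [1 / N] cost [N ^ (1 - s)], which tends to [0]. *)
Lemma hausdorff_measure_unit_itv_eq0 A s : A `<=` `[0, 1] -> 1 < s ->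
  hausdorff_measure s A = 0%E.
Proof.
move=> A01 s1; apply/eqP; rewrite eq_le; apply/andP; split; last first.
  apply: (@le_trans _ _ (hausdorff_premeasure s 1 A)); last first.
    by apply: ereal_sup_ubound; exists 1 => //=; exact: ltr01.
  apply: le_ereal_inf_tmp => _ [U _ <-].
  by apply: nneseries_ge0 => i _ _; exact: diam_powR_ge0.
apply: ge_ereal_sup => _ [d /= d0 <-].
apply/lee_addgt0Pr => e e0; rewrite add0e.
have s10 : 0 < s - 1 by rewrite subr_gt0.
(* The first bound makes the mesh [1 / N] at most [d], the second one makes the
   cost [N ^ (1 - s)] at most [e]. *)
pose N := (Num.truncn (Num.max d^-1 (e^-1 `^ (s - 1)^-1))).+1.
have [dN eN] : d^-1 <= N%:R /\ e^-1 `^ (s - 1)^-1 <= N%:R.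
  by apply/andP; rewrite -ge_max ltW// truncnS_gt.
have N0 : 0 < N%:R :> R by rewrite ltr0n.
pose U i : set R :=
  if (i < N)%N then `[i%:R / N%:R, i.+1%:R / N%:R]%classic else set0.
have Udiam i : (i < N)%N -> ediam (U i) = (N%:R^-1)%:E.
  move=> iN; rewrite /U iN ediam_itv; last first.
    by rewrite ler_pM2r ?invr_gt0// ler_nat.
  by rewrite -mulrBl -natr1 addrAC subrr add0r mul1r.
apply: ge_ereal_inf; exists (\sum_(0 <= i <oo) diam_powR s (U i))%E.
  exists U => //; split=> [i|x Ax].
    have [iN|iN] := ltnP i N.
      by rewrite Udiam// lee_fin -[d]invrK lef_pV2 ?posrE ?invr_gt0.
    rewrite /U ltnNge iN/= /ediam setX0 image_set0 ereal_sup0; exact: leNye.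
  have := A01 _ Ax; rewrite /= in_itv/= => /andP[x0 x1].
  have [x1'|x1'] := ltP x 1.
    have /andP[h1 h2] := @truncn_itv _ (x * N%:R) (mulr_ge0 x0 (ltW N0)).
    exists (Num.truncn (x * N%:R)) => //; rewrite /U.
    rewrite -[X in if X then _ else _](ltr_nat R) (le_lt_trans h1) ?gtr_pMl//=.
    by rewrite in_itv/= ler_pdivrMr// h1 ler_pdivlMr// ltW.
  (* Rounding [x * N] down would give the index [N] here, where [U] is empty. *)
  have -> : x = 1 by apply/le_anti; rewrite x1 x1'.
  exists N.-1 => //; rewrite /U /= leqnn/= in_itv/= ler_pdivrMr// ler_pdivlMr//.
  by rewrite mul1r !ler_nat leqnSn leqnn.
rewrite (nneseries_split _ N); last by move=> i _; exact: diam_powR_ge0.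
rewrite add0n eseries0; last first.
  by move=> i iN _; rewrite /U ltnNge iN/= /diam_powR; case: asboolP.
rewrite adde0 big_mkord.
rewrite (eq_bigr (fun=> ((N%:R^-1) `^ s)%:E)); last first.
  move=> i _; rewrite (@diam_powR_nonempty _ _ (i%:R / N%:R)).
    by rewrite Udiam.
  rewrite /U ltn_ord /= in_itv/= lexx/= ler_pM2r ?invr_gt0// ler_nat.
  exact: leqnSn.
rewrite sumEFin lee_fin sumr_const card_ord -[leLHS]mulr_natl.
have -> : N%:R * N%:R^-1 `^ s = (N%:R `^ (s - 1))^-1 :> R.
  rewrite -powR_inv1 ?ler0n// -powRrM mulN1r powRN powRB ?gt_eqF// powRr1 ?ler0n//.
  by rewrite invfM invrK mulrC.
rewrite -[leRHS]invrK lef_pV2 ?posrE ?invr_gt0 ?powR_gt0//.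
apply: le_trans (_ : (e^-1 `^ (s - 1)^-1) `^ (s - 1) <= _).
  by rewrite -powRrM mulVf ?gt_eqF// powRr1// invr_ge0 ltW.
by apply: ge0_ler_powR; rewrite ?nnegrE ?powR_ge0// ltW.
Qed.

Lemma hausdorff_dim_unit_itv_le1 A : A `<=` `[0, 1] -> (hausdorff_dim A <= 1)%E.
Proof.
move=> A01; apply/lee_addgt0Pr => e e0.
apply: ge_ereal_inf; exists (1 + e)%:E; last by rewrite EFinD.
exists (1 + e) => //; split; first by rewrite addr_ge0// ltW.
by apply: hausdorff_measure_unit_itv_eq0; rewrite // ltrDl.
Qed.

End HausdorffBounds.

(** * Distances between points with a common block of digits *)

Section DigitIntervals.
Variable R : realType.
Implicit Types (p q : nat -> nat) (x y k : R) (m n : nat).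

Definition digit_sequence p := (2 <= p 0)%N /\ forall n, (p n < p n.+1)%N.

Definition digit_prod p n : R := \prod_(i < n) ((p i)%:R - 1).

Lemma digit_ge p n : digit_sequence p -> (n.+2 <= p n)%N.
Proof. by case=> p0 pS; elim: n => // n IH; exact: leq_ltn_trans IH (pS n). Qed.

Lemma digit_gt1 p n : digit_sequence p -> 1 < (p n)%:R :> R.
Proof. by move=> /(digit_ge n) pn; rewrite ltr1n (leq_trans _ pn). Qed.

Lemma digit_prodS p n : digit_prod p n.+1 = digit_prod p n * ((p n)%:R - 1).
Proof. by rewrite /digit_prod big_ord_recr. Qed.

Lemma fact_le_digit_prod p n : digit_sequence p -> n`!%:R <= digit_prod p n.
Proof.
move=> dp; elim: n => [|n IH]; first by rewrite /digit_prod big_ord0.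
rewrite digit_prodS factS natrM mulrC ler_pM//.
by rewrite lerBrDr natr1 ler_nat digit_ge.
Qed.

Lemma digit_prod_gt0 p n : digit_sequence p -> 0 < digit_prod p n.
Proof.
move=> dp; apply: lt_le_trans (fact_le_digit_prod n dp).
by rewrite ltr0n fact_gt0.
Qed.

Lemma mengel_seriesS p n : series (mengel_term R p) n.+1 =
  series (mengel_term R p) n + (digit_prod p n * (p n)%:R)^-1.
Proof. by rewrite seriesSr. Qed.

Lemma mengel_series_nondecreasing p : digit_sequence p ->
  nondecreasing_seq (series (mengel_term R p)).
Proof.
move=> dp; apply/nondecreasing_seqP => n; rewrite mengel_seriesS lerDl.
by rewrite invr_ge0 mulr_ge0// ltW// digit_prod_gt0.
Qed.

(** The partial sums and these upper bounds are the ends of intervals that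
    enclose all points with the given first digits.  They are nested because
    [1 / (a - 1) = 1 / a + 1 / ((a - 1) a)] and the next digit minus [1] is at
    least [a]. *)
Lemma mengel_upper_nonincreasing p : digit_sequence p ->
  nonincreasing_seq
    (fun n => series (mengel_term R p) n + (digit_prod p n.+1)^-1).
Proof.
move=> dp; apply/nonincreasing_seqP => n.
rewrite mengel_seriesS -addrA lerD2l digit_prodS !digit_prodS.
set d := digit_prod p n; have d0 : 0 < d by exact: digit_prod_gt0.
have a1 := digit_gt1 n dp; set a := (p n)%:R in a1 *.
have ab : a <= (p n.+1)%:R - 1.
  by rewrite lerBrDr natr1 ler_nat; case: dp.
set b := _ - 1 in ab *.
have -> : (d * (a - 1))^-1 = (d * a)^-1 + (d * (a - 1) * a)^-1.
  by field; rewrite !gt_eqF//; lra.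
have [a0 a10 b0] : [/\ 0 < a, 0 < a - 1 & 0 < b] by split; lra.
by rewrite lerD2l lef_pV2 ?posrE ?mulr_gt0// ler_pM2l// mulr_gt0.
Qed.

Lemma mengel_series_le_upper p m n : digit_sequence p ->
  series (mengel_term R p) m <=
  series (mengel_term R p) n + (digit_prod p n.+1)^-1.
Proof.
move=> dp; pose N := maxn m n.
apply: le_trans (mengel_upper_nonincreasing dp (leq_maxr m n)).
apply: le_trans (mengel_series_nondecreasing dp (leq_maxl m n)) _.
by rewrite lerDl invr_ge0 ltW// digit_prod_gt0.
Qed.

Lemma mengel_expansion_sum p : digit_sequence p ->
  is_mengel_expansion (limn (series (mengel_term R p))) p.
Proof.
move=> dp; have [p0 pS] := dp; split=> // [n|]; first by rewrite addn1.
apply: nondecreasing_is_cvgn; first exact: mengel_series_nondecreasing.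
exists (series (mengel_term R p) 0 + (digit_prod p 1)^-1) => _ [m _ <-].
exact: mengel_series_le_upper.
Qed.

Lemma mengel_expansion_itv p n x : is_mengel_expansion x p ->
  series (mengel_term R p) n <= x <=
  series (mengel_term R p) n + (digit_prod p n.+1)^-1.
Proof.
case=> p0 pS px.
have dp : digit_sequence p by split=> // m; rewrite -addn1.
apply/andP; split.
  apply: cvgr_to_ge px _; near=> m.
  by apply: mengel_series_nondecreasing => //; near: m; exact: nbhs_infty_ge.
by apply: cvgr_to_le px _; near=> m; exact: mengel_series_le_upper.
Unshelve. all: by end_near. Qed.

Lemma mengel_expansion01 p x : is_mengel_expansion x p -> 0 < x <= 1.
Proof.
move=> ex; have [p0 pS _] := ex.
have dp : digit_sequence p by split=> // m; rewrite -addn1.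
have /andP[h1 _] := mengel_expansion_itv 1 ex.
have /andP[_ h2] := mengel_expansion_itv 0 ex.
apply/andP; split.
  apply: lt_le_trans h1; rewrite mengel_seriesS /series/= big_geq// add0r.
  by rewrite invr_gt0 mulr_gt0 ?digit_prod_gt0// (lt_trans _ (digit_gt1 0 dp)).
apply: le_trans h2 _; rewrite /series/= big_geq// add0r.
have h : 1 <= digit_prod p 1 := fact_le_digit_prod 1 dp.
by rewrite invf_le1// (lt_le_trans _ h).
Qed.

Lemma eq_digit_prod p q n : (forall i, (i < n)%N -> p i = q i) ->
  digit_prod p n = digit_prod q n.
Proof. by move=> pq; apply: eq_bigr => i _; rewrite pq. Qed.

Lemma eq_mengel_series p q n : (forall i, (i < n)%N -> p i = q i) ->
  series (mengel_term R p) n = series (mengel_term R q) n.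
Proof.
move=> pq; rewrite /series/= !big_mkord; apply: eq_bigr => i _.
rewrite /mengel_term pq//; congr (_ * _)^-1.
by apply: eq_digit_prod => j ji; rewrite pq// (ltn_trans ji).
Qed.

Lemma mengel_dist_le p q n x y :
  is_mengel_expansion x p -> is_mengel_expansion y q ->
  (forall i, (i <= n)%N -> p i = q i) ->
  `|x - y| <= (digit_prod p n.+1)^-1.
Proof.
move=> /(mengel_expansion_itv n) + /(mengel_expansion_itv n) + pq.
rewrite -(@eq_mengel_series p q n) => [|i /ltnW]; last exact: pq.
rewrite -(@eq_digit_prod p q n.+1)// => /andP[h1 h2] /andP[h3 h4].
by rewrite ler_norml; lra.
Qed.

(** Here [b > a] are the first digits at which two expansions differ and [c] is
    the digit that follows [a].  The right-hand side is, up to the common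
    factor, what the first two terms after the split contribute to the larger
    point minus the most that the smaller point can gain after the split.  For
    [b = a + 1] the first and last terms cancel and only the term with [c] is
    left, which is why an upper bound on [c] is required. *)
Lemma mengel_gap_ge (a b c k : R) : 1 < k -> 1 < a -> a + 1 <= b -> 0 < c ->
  c <= k * a -> (b - a) / (k * (a * b)) <= a^-1 + ((a - 1) * c)^-1 - (b - 1)^-1.
Proof.
move=> k1 a1 ab c0 ck.
have [a0 b0 k0] : [/\ 0 < a, 0 < b & 0 < k] by split; lra.
have h1 : (k * (a * b))^-1 <= ((a - 1) * c)^-1.
  rewrite lef_pV2 ?posrE ?mulr_gt0 ?subr_gt0//.
  have -> : k * (a * b) = b * (k * a) by ring.
  by apply: ler_pM => //; lra.
have h2 : (b - 1 - a) / (a * b) <= a^-1 - (b - 1)^-1.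
  have -> : a^-1 - (b - 1)^-1 = (b - 1 - a) / (a * (b - 1)).
    by field; rewrite !gt_eqF//; lra.
  apply: ler_wpM2l; first by lra.
  by rewrite lef_pV2 ?posrE ?mulr_gt0// ?ler_pM2l//; lra.
(* As [k > 1], the loss of one unit in [b - 1 - a] is made up for by the term
   that comes from [c]. *)
have -> : (b - a) / (k * (a * b)) =
    (b - 1 - a) / (a * b) + (k * (a * b))^-1
    - (b - 1 - a) * (k - 1) / (k * (a * b)).
  by field; rewrite !gt_eqF.
have : 0 <= (b - 1 - a) * (k - 1) / (k * (a * b)).
  by rewrite !mulr_ge0 ?invr_ge0 ?mulr_ge0//; lra.
lra.
Qed.

(** The point with the smaller digit is the larger one: after the common part of
    the two expansions it has at least two more terms, whereas the other point
    stays below the upper end of its interval. *)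
Lemma mengel_dist_ge p q n x y k : 1 < k ->
  is_mengel_expansion x p -> is_mengel_expansion y q ->
  (forall i, (i <= n)%N -> p i = q i) -> (q n.+1 < p n.+1)%N ->
  (p n.+1)%:R <= k * (p n)%:R -> (q n.+2)%:R <= k * (q n.+1)%:R ->
  ((p n.+1)%:R - (q n.+1)%:R) / (k ^+ 3 * (p n)%:R ^+ 2 * digit_prod p n.+1)
    <= `|x - y|.
Proof.
move=> k1 ex ey pq qp pk qk.
have dp : digit_sequence p by case: ex => p0 pS _; split=> // m; rewrite -addn1.
have dq : digit_sequence q by case: ey => p0 pS _; split=> // m; rewrite -addn1.
have pq' i : (i < n.+1)%N -> p i = q i by rewrite ltnS; exact: pq.
have /andP[_ xU] := mengel_expansion_itv n.+1 ex.
have /andP[yL _] := mengel_expansion_itv n.+3 ey.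
rewrite (digit_prodS p n.+1) in xU.
rewrite 2!mengel_seriesS -(eq_mengel_series pq') in yL.
rewrite (digit_prodS q n.+1) -(eq_digit_prod pq') in yL.
have d0 := digit_prod_gt0 n.+1 dp.
have P1 := digit_gt1 n dp; have a1 := digit_gt1 n.+1 dq.
have c1 := digit_gt1 n.+2 dq.
have ab : (q n.+1)%:R + 1 <= (p n.+1)%:R :> R by rewrite natr1 ler_nat.
set d := digit_prod p n.+1 in d0 xU yL *.
set S := series _ _ in xU yL.
set P := (p n)%:R in P1 pk *; set a := (q n.+1)%:R in a1 ab qk yL *.
set b := (p n.+1)%:R in ab pk xU *; set c := (q n.+2)%:R in c1 qk yL.
have gap := mengel_gap_ge k1 a1 ab (lt_trans ltr01 c1) qk.
have [a0 b0 k0] : [/\ 0 < a, 0 < b & 0 < k] by split; lra.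
have P0 : 0 < P by lra.
apply: (@le_trans _ _ (d^-1 * ((b - a) / (k * (a * b))))).
  have -> : (b - a) / (k ^+ 3 * P ^+ 2 * d) =
      d^-1 * ((b - a) / (k * ((k * P) * (k * P)))).
    by field; rewrite !gt_eqF.
  apply: ler_wpM2l; first by rewrite invr_ge0 ltW.
  apply: ler_wpM2l; first by lra.
  rewrite lef_pV2 ?posrE ?mulr_gt0// ler_pM2l//.
  by apply: ler_pM; lra.
apply: (@le_trans _ _ (y - x)); last by rewrite distrC ler_norm.
apply: le_trans (_ : d^-1 * (a^-1 + ((a - 1) * c)^-1 - (b - 1)^-1) <= _).
  by apply: ler_wpM2l gap; rewrite invr_ge0 ltW.
rewrite mulrBr mulrDr -!invfM mulrA.
lra.
Qed.

End DigitIntervals.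

(** * Coding the unit interval by admissible digit sequences *)

Section Coding.
Variables (R : realType) (k : R) (M : nat).
Hypotheses (k1 : 1 < k) (M2 : (2 <= M)%N) (kM : 4 <= (k - 1) * M%:R).
Implicit Types (m n q : nat) (t : R).

(** The digits allowed after [q] are those from [q + 1] to the integer part of
    [k q]. *)
Definition branches q : nat := (Num.truncn (k * q%:R) - q)%N.

(** One step of a mixed-radix expansion.  The state consists of the current digit
    and of the fractional part still to be expanded; the integer part of
    [branches q * t] selects one of the digits that may follow [q]. *)
Definition code_step (z : nat * R) : nat * R :=
  let w := (branches z.1)%:R * z.2 in
  ((z.1 + (Num.truncn w).+1)%N, w - (Num.truncn w)%:R).

Definition code_state t n := iter n code_step (M, t).

Definition code t n : nat := (code_state t n).1.

Let k_ge0 : 0 <= k. Proof. exact: le_trans ler01 (ltW k1). Qed.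

Let c_ge0 : 0 <= (k - 1) / 2. Proof. by rewrite divr_ge0// subr_ge0 ltW. Qed.

Let le_k q : (M <= q)%N -> 4 <= (k - 1) * q%:R.
Proof.
move=> Mq; apply: le_trans kM _.
by rewrite ler_pM2l ?subr_gt0// ler_nat.
Qed.

Lemma branchesE q : (M <= q)%N ->
  (branches q)%:R = (Num.truncn (k * q%:R))%:R - q%:R :> R.
Proof.
move=> Mq; rewrite natrB// truncn_ge_nat; last exact: mulr_ge0.
by rewrite ler_peMl// ltW.
Qed.

(** The integer part costs at most [1], which is at most half of [(k - 1) q]
    since the first digit is large. *)
Lemma branches_ge q : (M <= q)%N ->
  (k - 1) / 2 * q%:R <= (branches q)%:R :> R.
Proof.
move=> Mq; rewrite branchesE//; have := le_k Mq.
have := truncnS_gt (k * q%:R); rewrite -natr1; lra.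
Qed.

Lemma branches_ge2 q : (M <= q)%N -> 2 <= (branches q)%:R :> R.
Proof. by move=> /[dup] /branches_ge + /le_k; lra. Qed.

Lemma code_step_spec z : (M <= z.1)%N -> 0 <= z.2 < 1 ->
  [/\ (z.1 < (code_step z).1)%N, (code_step z).1%:R <= k * z.1%:R &
      0 <= (code_step z).2 < 1].
Proof.
case: z => q t /= Mq /andP[t0 t1]; have b2 := branches_ge2 Mq.
have bE := branchesE Mq; set b := (branches q)%:R in b2 bE *.
have w0 : 0 <= b * t by rewrite mulr_ge0//; lra.
have /andP[jw wj] := truncn_itv w0.
have wb : b * t < b by rewrite gtr_pMr//; lra.
split; first by rewrite -addSnnS leq_addr.
  have jb : (Num.truncn (b * t) < branches q)%N by rewrite truncn_lt_nat.
  rewrite natrD; apply: (@le_trans _ _ (q%:R + b)).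
    by rewrite lerD2l ler_nat.
  by rewrite bE addrC subrK truncn_le mulr_ge0.
by rewrite subr_ge0 jw ltrBlDl natr1.
Qed.

Lemma code_state_spec t n : 0 <= t < 1 ->
  (M <= code t n)%N /\ 0 <= (code_state t n).2 < 1.
Proof.
move=> t01; elim: n => [//|n [Mn tn]].
have [h1 _ h3] := code_step_spec Mn tn.
by split=> //; apply: leq_trans Mn (ltnW h1).
Qed.

Lemma code_lt t n : 0 <= t < 1 -> (code t n < code t n.+1)%N.
Proof.
by move=> /(code_state_spec n)[Mn tn]; have [] := code_step_spec Mn tn.
Qed.

Lemma code_le t n : 0 <= t < 1 -> (code t n.+1)%:R <= k * (code t n)%:R.
Proof.
by move=> /(code_state_spec n)[Mn tn]; have [] := code_step_spec Mn tn.
Qed.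

Lemma code_digit_sequence t : 0 <= t < 1 -> digit_sequence (code t).
Proof. by move=> t01; split=> // n; exact: code_lt. Qed.

Lemma code_le_exp t n : 0 <= t < 1 -> (code t n)%:R <= k ^+ n * M%:R.
Proof.
move=> t01; elim: n => [|n IH]; first by rewrite mul1r.
apply: le_trans (code_le n t01) _; by rewrite exprS -mulrA ler_wpM2l.
Qed.

Definition branch_prod t n : R := \prod_(i < n) (branches (code t i))%:R.

Lemma branch_prodS t n :
  branch_prod t n.+1 = branch_prod t n * (branches (code t n))%:R.
Proof. by rewrite /branch_prod big_ord_recr. Qed.

(** Mass against length: a block given by [n] choices carries the
    mass [1 / branch_prod t n] of the parameter interval, and this exceeds
    [1 / digit_prod] at most by an exponential factor. *)
Lemma branch_prod_ge t n : 0 <= t < 1 ->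
  ((k - 1) / 2) ^+ n * digit_prod R (code t) n <= branch_prod t n.
Proof.
move=> t01; elim: n => [|n IH].
  by rewrite /digit_prod /branch_prod !big_ord0 mul1r.
have [Mn _] := code_state_spec n t01.
rewrite digit_prodS branch_prodS exprSr.
have -> (a b c d : R) : a * b * (c * d) = (a * c) * (b * d) by ring.
have d1 := digit_gt1 R n (code_digit_sequence t01).
apply: ler_pM => //.
- rewrite mulr_ge0 ?exprn_ge0// ltW// digit_prod_gt0//.
  exact: code_digit_sequence.
- by rewrite mulr_ge0// subr_ge0 ltW.
- by apply: le_trans (branches_ge Mn); rewrite ler_wpM2l// gerBl.
Qed.

Lemma branch_prod_ge2 t n : 0 <= t < 1 -> 2 ^+ n <= branch_prod t n.
Proof.
move=> t01; rewrite -[n in leLHS]card_ord -prodr_const; apply: ler_prod => i _.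
have [Mi _] := code_state_spec i t01.
by rewrite ler0n/=; exact: branches_ge2.
Qed.

Lemma code_stateS t n : (code t n.+1)%:R + (code_state t n.+1).2 =
  (code t n)%:R + 1 + (branches (code t n))%:R * (code_state t n).2.
Proof.
rewrite /code /= -/(code_state t n) natrD -natr1 -/(code t n).
set w := _ * (code_state t n).2; ring.
Qed.

(** Along a common block of digits, each step multiplies the difference of the
    parameters by the radix and subtracts the same integer from both. *)
Lemma code_common_prefix t t' n :
  (forall i, (i <= n)%N -> code t i = code t' i) ->
  (t - t') * branch_prod t n = (code_state t n).2 - (code_state t' n).2.
Proof.
elim: n => [|n IH] tt'; first by rewrite /branch_prod big_ord0 mulr1.
rewrite branch_prodS mulrA.
rewrite IH; last by move=> i /leqW; exact: tt'.
have := code_stateS t n; have := code_stateS t' n.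
by rewrite -(tt' n)// -(tt' n.+1)//; lra.
Qed.

(** At the step where the digits may split, the difference of the parameters is
    multiplied by the last radix and becomes the difference of the digits plus
    a difference of fractional parts. *)
Lemma code_split_dist t t' n : 0 <= t < 1 -> 0 <= t' < 1 ->
  (forall i, (i <= n)%N -> code t i = code t' i) ->
  `|t - t'| * branch_prod t n.+1 <=
  `|(code t n.+1)%:R - (code t' n.+1)%:R| + 1.
Proof.
move=> t01 t01' tt'.
have [_ h] := code_state_spec n.+1 t01; have [_ h'] := code_state_spec n.+1 t01'.
have b0 : 0 <= branch_prod t n.+1.
  by apply: le_trans (branch_prod_ge2 n.+1 t01); rewrite exprn_ge0.
rewrite -[X in _ * X](ger0_norm b0) -normrM.
have -> : (t - t') * branch_prod t n.+1 =
    ((code t n.+1)%:R - (code t' n.+1)%:R) +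
    ((code_state t n.+1).2 - (code_state t' n.+1).2).
  rewrite branch_prodS mulrA.
  rewrite code_common_prefix//.
  by have := code_stateS t n; have := code_stateS t' n; rewrite -(tt' n)//; lra.
apply: le_trans (ler_normD _ _) _; rewrite lerD2l.
by move: h h' => /andP[? ?] /andP[? ?]; rewrite ler_norml; lra.
Qed.

(** Each radix is at least [2], so that parameters with the same digits at all
    steps are within [2 ^- n] of each other for all [n].  All codes start with
    the digit [M], hence the first difference has a positive index. *)
Lemma code_first_difference t t' : 0 <= t < 1 -> 0 <= t' < 1 -> t != t' ->
  exists2 n, (forall i, (i <= n)%N -> code t i = code t' i) &
    code t n.+1 != code t' n.+1.
Proof.
move=> t01 t01' tt'.
have [[m]|same] := pselect (exists m, code t m != code t' m).
  move=> cm; have := ex_minnP (ex_intro (fun m => code t m != code t' m) m cm).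
  case=> -[/eqP//|n] cn nmin; exists n => // i i_n.
  by apply/eqP/negPn/negP => /nmin; rewrite ltnNge i_n.
have {}same i : code t i = code t' i.
  by apply/eqP/negPn/negP => h; apply: same; exists i.
have d0 : 0 < `|t - t'| by rewrite normr_gt0 subr_eq0.
pose n := Num.truncn (`|t - t'|^-1).
have := @code_split_dist t t' n t01 t01' (fun i _ => same i).
rewrite same subrr normr0 add0r => /(le_trans _) h.
have h2 : `|t - t'| * 2 ^+ n.+1 <= 1.
  by apply: h; rewrite ler_pM2l//; exact: branch_prod_ge2.
suff : 1 < `|t - t'| * 2 ^+ n.+1 by rewrite ltNge h2.
rewrite mulrC -ltr_pdivrMr// mul1r.
apply: lt_trans (truncnS_gt _) _; rewrite -/n.
by rewrite -natrX ltr_nat ltn_expl.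
Qed.

End Coding.

(** * Exponential growth against factorial decay *)

Section SuperexponentialDecay.
Variable R : realType.
Implicit Types (x B d s : R).

Lemma exprn_le_expR_fact x n : 0 <= x -> x ^+ n <= expR x * n`!%:R.
Proof.
move=> x0; case: n => [|n]; first by rewrite mulr1 expr0 -expR0 ler_expR.
rewrite -ler_pdivrMr ?ltr0n ?fact_gt0//.
by apply: le_trans (expR_ge1Dxn n x0); rewrite lerDr.
Qed.

(** This absorbs an exponential factor into a loss of exponent: split [d] as
    [d ^ (1 - s) * d ^ s]; as [d <= 1 / n!], the quantity [B ^ n * d ^ (1 - s)]
    is at most the power [1 - s] of [x ^ n / n!] with [x ^ (1 - s) = B], and
    [x ^ n / n!] is a term of the exponential series. *)
Lemma exprn_mul_small_le B s d n : 0 <= B -> 0 <= s -> s < 1 ->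
  0 <= d -> d * n`!%:R <= 1 ->
  B ^+ n * d <= expR (B `^ (1 - s)^-1) `^ (1 - s) * d `^ s.
Proof.
move=> B0 s0 s1 d0 dn; have e0 : 0 < 1 - s by rewrite subr_gt0.
set x := B `^ _; have x0 : 0 <= x by exact: powR_ge0.
have -> : B ^+ n = (x ^+ n) `^ (1 - s).
  rewrite -[x ^+ n]powR_mulrn// -powRrM mulrC powRrM -(powRrM B) mulVf ?gt_eqF//.
  by rewrite powRr1// powR_mulrn.
have {1}-> : d = d `^ (1 - s) * d `^ s.
  by rewrite -powRD ?subrK ?powRr1// oner_eq0.
rewrite mulrA ler_wpM2r ?powR_ge0// -powRM ?exprn_ge0//.
apply: ge0_ler_powR; rewrite ?nnegrE ?mulr_ge0 ?exprn_ge0 ?expR_ge0//.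
  exact: ltW.
apply: le_trans (ler_wpM2r d0 (exprn_le_expR_fact n x0)) _.
by rewrite -mulrA [n`!%:R * d]mulrC ler_piMr// expR_ge0.
Qed.

End SuperexponentialDecay.

(** * The coding has a Hölder inverse *)

Section HolderCoding.
Variables (R : realType) (k : R) (M : nat).
Hypotheses (k1 : 1 < k) (M2 : (2 <= M)%N) (kM : 4 <= (k - 1) * M%:R).

Definition coded_point (t : R) : R := limn (series (mengel_term R (code k M t))).

Lemma coded_pointP t : 0 <= t < 1 ->
  is_mengel_expansion (coded_point t) (code k M t).
Proof.
by move=> t01; apply: mengel_expansion_sum; exact: code_digit_sequence.
Qed.

(** The constants collect the losses: the comparison of the radices with the
    digits costs [(k - 1) / 2] at each of [n + 1] steps, the factor
    [k ^ 3 * p_n ^ 2] of the separation of points is bounded by means of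
    [p_n <= k ^ n * M], and a last factor [2] turns the difference of the digits
    plus one into that difference. *)
Lemma coded_point_locally_lipschitz t t' n : 0 <= t < 1 -> 0 <= t' < 1 ->
  (forall i, (i <= n)%N -> code k M t i = code k M t' i) ->
  (code k M t' n.+1 < code k M t n.+1)%N ->
  `|t - t'| <= 4 * k ^+ 3 * M%:R ^+ 2 / (k - 1) *
    (2 * k ^+ 2 / (k - 1)) ^+ n * `|coded_point t - coded_point t'|.
Proof.
move=> t01 t01' tt' lt_n.
have k0 : 0 < k := lt_trans ltr01 k1.
have k10 : 0 < k - 1 by rewrite subr_gt0.
have := mengel_dist_ge k1 (coded_pointP t01) (coded_pointP t01') tt' lt_n
  (code_le k1 kM n t01) (code_le k1 kM n.+1 t01').
have := code_split_dist k1 kM t01 t01' tt'.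
have := branch_prod_ge k1 M2 kM n.+1 t01.
have := code_le_exp k1 kM n t01.
have := digit_prod_gt0 R n.+1 (code_digit_sequence k1 M2 kM t01).
have := digit_gt1 R n (code_digit_sequence k1 M2 kM t01).
set d := digit_prod _ _ _; set P := (code k M t n)%:R.
set u := `|t - t'|; set v := `|coded_point t - _|.
set b := (code k M t n.+1)%:R; set a := (code k M t' n.+1)%:R.
have ab : 1 <= b - a by rewrite lerBrDr nat1r ler_nat.
set Pi := branch_prod _ _ _ _ => P1 d0 PM dPi uPi abv.
have u0 : 0 <= u by exact: normr_ge0.
have v0 : 0 <= v by exact: normr_ge0.
have M0 : 0 < M%:R :> R by rewrite ltr0n (leq_trans _ M2).
have c0 : 0 < (k - 1) / 2 by rewrite divr_gt0.
have P0 : 0 < P by exact: lt_trans P1.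
have abv' : b - a <= v * (k ^+ 3 * P ^+ 2 * d).
  by rewrite -ler_pdivrMr// !mulr_gt0 ?exprn_gt0.
have h1 : u * (((k - 1) / 2) ^+ n.+1 * d) <=
    2 * (v * (k ^+ 3 * (k ^+ n * M%:R) ^+ 2 * d)).
  apply: (le_trans (ler_wpM2l u0 dPi)); apply: (le_trans uPi).
  rewrite ger0_norm; last by lra.
  apply: (@le_trans _ _ (2 * (b - a))); first by lra.
  rewrite ler_pM2l//; apply: (le_trans abv'); apply: ler_wpM2l => //.
  apply: ler_wpM2r; first exact: ltW.
  apply: ler_wpM2l; first by rewrite exprn_ge0// ltW.
  by rewrite ler_pXn2r ?nnegrE// (ltW P0, le_trans (ltW P0) PM).
have cd0 : 0 < ((k - 1) / 2) ^+ n.+1 * d by rewrite mulr_gt0 ?exprn_gt0.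
move: h1; rewrite -ler_pdivlMr// => /le_trans; apply.
rewrite le_eqVlt; apply/orP; left; apply/eqP.
have -> : (2 * k ^+ 2 / (k - 1)) ^+ n = 2 ^+ n * (k ^+ n) ^+ 2 / (k - 1) ^+ n.
  by rewrite expr_div_n exprMn exprAC.
rewrite expr_div_n [(k - 1) ^+ n.+1]exprS [2 ^+ n.+1]exprS.
have := exprn_gt0 n k10; have := exprn_gt0 n (@ltr0Sn R 1).
move: (2 ^+ n) ((k - 1) ^+ n) (k ^+ n) => x y z x0 y0.
by field; rewrite !gt_eqF.
Qed.

Lemma coded_point_holder s : 0 <= s -> s < 1 -> exists2 C, 0 < C &
  forall t t', 0 <= t < 1 -> 0 <= t' < 1 ->
    `|t - t'| <= C * `|coded_point t - coded_point t'| `^ s.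
Proof.
move=> s0 s1; have k0 : 0 < k := lt_trans ltr01 k1.
have k10 : 0 < k - 1 by rewrite subr_gt0.
have M0 : 0 < M%:R :> R by rewrite ltr0n (leq_trans _ M2).
pose A := 4 * k ^+ 3 * M%:R ^+ 2 / (k - 1); pose B := 2 * k ^+ 2 / (k - 1).
have A0 : 0 < A by rewrite divr_gt0// !mulr_gt0 ?exprn_gt0.
have B0 : 0 < B by rewrite divr_gt0// mulr_gt0 ?exprn_gt0.
pose E := expR (B `^ (1 - s)^-1) `^ (1 - s).
have E0 : 0 < E by rewrite powR_gt0 ?expR_gt0.
exists (A * E); first exact: mulr_gt0.
move=> t t' t01 t01'.
have [->|tt'] := eqVneq t t'.
  by rewrite subrr normr0 mulr_ge0 ?powR_ge0//; exact/ltW/mulr_gt0.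
have [n eq_n ne_n] := code_first_difference k1 kM t01 t01' tt'.
wlog lt_n : t t' t01 t01' eq_n ne_n tt' / (code k M t' n.+1 < code k M t n.+1)%N.
  move=> H; have := ne_n; rewrite neq_ltn => /orP[h|h]; last exact: H.
  rewrite distrC [`|coded_point t - _|]distrC; apply: H => //.
  - by move=> i /eq_n.
  - by rewrite eq_sym.
  - by rewrite eq_sym.
apply: le_trans (coded_point_locally_lipschitz t01 t01' eq_n lt_n) _.
rewrite -/A -/B -2!(mulrA A) ler_pM2l//.
apply: exprn_mul_small_le => //; first exact: ltW.
have dt := code_digit_sequence k1 M2 kM t01.
have d0 := digit_prod_gt0 R n.+1 dt.
have := mengel_dist_le (coded_pointP t01) (coded_pointP t01') eq_n.
rewrite -div1r ler_pdivlMr// => /(le_trans _); apply.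
rewrite ler_wpM2l//; apply: le_trans (fact_le_digit_prod R n.+1 dt).
by rewrite ler_nat factS leq_pmull.
Qed.

End HolderCoding.

Theorem theorem6p3 (R : realType) (k : R) (hk : 1 < k) :
  hausdorff_dim [set x : R | 0 < x <= 1 /\
    forall n : nat, (mengel_digit x n.+1)%:R / (mengel_digit x n)%:R <= k]
  = 1%E.
Proof.
set A := [set x : R | _]; apply/eqP; rewrite eq_le; apply/andP; split.
  apply: hausdorff_dim_unit_itv_le1 => x [/andP[x0 x1] _].
  by rewrite /= in_itv/= x1 ltW.
apply: le_ereal_inf_tmp => _ [s [s0 As] <-]; rewrite lee_fin leNgt.
apply/negP => s1.
(* The first digit must be large for a ratio close to [1] to leave a choice. *)
pose M := (Num.truncn (4 / (k - 1))).+2.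
have kM : 4 <= (k - 1) * M%:R.
  rewrite mulrC -ler_pdivrMr ?subr_gt0// ltW//.
  by apply: lt_trans (truncnS_gt _) _; rewrite ltr_nat.
have M2 : (2 <= M)%N by [].
have [C C0 gH] := coded_point_holder hk M2 kM s0 s1.
(* The coded points lie in the set, because the digits of an expansion are
   unique. *)
suff gA t : 0 <= t < 1 -> A (coded_point k M t).
  by have := holder_hausdorff_measure_gt0 s0 C0 gA gH; rewrite As ltxx.
move=> t01; have gt := coded_pointP hk M2 kM t01.
have g01 := mengel_expansion01 gt; split=> // n.
rewrite (mengel_expansion_unique (mengel_digitP g01) gt).
have := digit_gt1 R n (code_digit_sequence hk M2 kM t01) => c1.
by rewrite ler_pdivrMr ?(code_le hk kM)// (lt_trans _ c1).
Qed.
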